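(* Let $G=(V=V_1\sqcup V_2,E)$ be a turn-based game with $n$ vertices, let $r\colon E\to\mathbb{Z}$ be a reward function with $W=\max_{(v,u)\in E}|r(v,u)|$, and let $\lambda\in[0,1)$ be a discount factor. Then the strategy iteration algorithm (described in the context) computes an optimal player-1 strategy (and hence solves the value problem) after at most $n^{\mathcal{O}\left(W^{1/4}\sqrt{n}\right)}$ iterations, from any initial player-1 strategy.
   Context: A turn-based game $G=(V=V_1\sqcup V_2,E)$ is a finite directed graph whose vertex set $V$ ($|V|=n$) is partitioned into player-1 vertices $V_1$ and player-2 vertices $V_2$, and every vertex $v$ has a non-empty set of successors $E(v)=\{u:(v,u)\in E\}$. A play is an infinite sequence $\langle v_0,v_1,\dots\rangle$ with $v_{t+1}\in E(v_t)$. Given rewards $r\colon E\to\mathbb{Z}$ and $\lambda\in[0,1)$, the discounted payoff of a play is $\mathrm{Disc}_\lambda(\langle v_0,v_1,\dots\rangle)=\sum_{i\ge0}\lambda^i r(v_i,v_{i+1})$; player 1 maximizes and player 2 minimizes it. A positional strategy for player 1 (resp. 2) is a map $\sigma\colon V_1\to V$ (resp. $\tau\colon V_2\to V$) with $\sigma(v)\in E(v)$; a profile $(\sigma,\tau)$ and a start vertex $v$ determine a unique (lasso-shaped) play $G_v^{\sigma,\tau}$. The value of $v$ is $\mathrm{val}_\lambda(v)=\max_\sigma\min_\tau \mathrm{Disc}_\lambda(G_v^{\sigma,\tau})$ over positional strategies; $\sigma$ is optimal if $\min_\tau\mathrm{Disc}_\lambda(G_v^{\sigma,\tau})=\mathrm{val}_\lambda(v)$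 for all $v$. A best response to $\sigma$ is a player-2 strategy $\tau$ with $\mathrm{Disc}_\lambda(G_v^{\sigma,\tau})\le \mathrm{Disc}_\lambda(G_v^{\sigma,\tau'})$ for all $\tau'$ and all $v$. For $f\colon V\to\mathbb{R}$, the Bellman strategy extractor $\mathcal{B}_{G,\lambda}(f)$ picks at $v\in V_1$ an $\arg\max_{u\in E(v)} r(v,u)+\lambda f(u)$ and at $v\in V_2$ an $\arg\min_{u\in E(v)} r(v,u)+\lambda f(u)$, with ties resolved by a fixed rule independent of $\lambda$ (e.g. least index in a fixed vertex indexing). Strategy iteration: starting from an arbitrary player-1 strategy $\sigma^0$, at iteration $k$ compute a best response $\tau^k$ to $\sigma^k$, set $\sigma^{k+1}=\mathcal{B}_{G,\lambda}$ applied to the vector $v\mapsto \mathrm{Disc}_\lambda(G_v^{\sigma^k,\tau^k})$ (restricted to player-1 vertices), and stop when $\sigma^{k+1}=\sigma^k$, returning $\sigma^k$. *)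

(* Defs.v *)
From HB Require Import structures.
From mathcomp Require Import all_boot all_order all_algebra.
From mathcomp Require Import all_classical all_reals all_analysis.
Set Implicit Arguments. Unset Strict Implicit. Unset Printing Implicit Defensive.
Import Order.TTheory GRing.Theory Num.Theory.
Import numFieldNormedType.Exports.
Local Open Scope ring_scope.

(* A turn-based game on the finite vertex type V:
   owner v = true  <-> v is a player-1 vertex (V_1),
   owner v = false <-> v is a player-2 vertex (V_2),
   E : rel V is the edge relation, rewards r : V -> V -> int
   (only values on edges matter). *)

Section Game.
Variables (V : finType) (owner : V -> bool) (E : rel V).

Definition game_ok : Prop := forall v, exists u, E v u.

(* positional strategies are maps V -> V; only their values on the
   owner's vertices matter *)
Definition strat1 (s : V -> V) : Prop := forall v, owner v -> E v (s v).
Definition strat2 (t : V -> V) : Prop := forall v, ~~ owner v -> E v (t v).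

Definition eq_strat1 (s s' : V -> V) : Prop := forall v, owner v -> s v = s' v.

Definition next (s t : V -> V) (v : V) : V := if owner v then s v else t v.
Definition play (s t : V -> V) (v : V) (i : nat) : V := iter i (next s t) v.

Variables (R : realType).

Definition Disc (r : V -> V -> int) (lam : R) (s t : V -> V) (v : V) : R :=
  limn (series (fun i : nat => lam ^+ i * (r (play s t v i) (play s t v i.+1))%:~R)).

Definition best_response r lam (s t : V -> V) : Prop :=
  strat2 t /\ forall t', strat2 t' -> forall v, Disc r lam s t v <= Disc r lam s t' v.

(* s is optimal: for every v, min_t Disc(s,t,v) = max_s' min_t Disc(s',t,v)
   = val_lam(v).  (Unfolded: min_t Disc(s,.,v) >= min_t Disc(s',.,v) for
   every s'; the max is then attained by s.) *)
Definition optimal r lam (s : V -> V) : Prop :=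
  strat1 s /\
  forall v s', strat1 s' ->
    exists t, strat2 t /\ forall t', strat2 t' -> Disc r lam s' t v <= Disc r lam s t' v.

(* Bellman strategy extractor, ties broken by least index in the fixed
   enumeration order of V (the first element of enum V that is optimal). *)
Definition bellman (r : V -> V -> int) (lam : R) (f : V -> R) (v : V) : V :=
  let q u := (r v u)%:~R + lam * f u in
  if owner v then
    odflt v [pick u | E v u && [forall w, E v w ==> (q w <= q u)]]
  else
    odflt v [pick u | E v u && [forall w, E v w ==> (q u <= q w)]].

Definition maxabs (r : V -> V -> int) : nat :=
  \max_(p : V * V | E p.1 p.2) `|r p.1 p.2|%N.

Definition SI_run r lam (s0 : V -> V) (sig tau : nat -> V -> V) : Prop :=
  [/\ sig 0%N = s0,
      forall k, best_response r lam (sig k) (tau k) &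
      forall k, sig k.+1 = bellman r lam (Disc r lam (sig k) (tau k))].

End Game.

(* Main.v *)
Require Import Defs.
From HB Require Import structures.
From mathcomp Require Import all_boot all_order all_algebra.
From mathcomp Require Import all_classical all_reals all_analysis.
From mathcomp Require Import ring lra zify.
Import Order.TTheory GRing.Theory Num.Theory.
Import numFieldNormedType.Exports.
Local Open Scope ring_scope.

(** The argument of Hansen, Miltersen and Zwick bounds the number of iterations
    polynomially in n and 1 / (1 - lam), so only lam close to 1 is a problem.
    Every comparison made by the algorithm is between payoffs of lassos, hence is
    decided by the sign at lam of an integer polynomial of degree at most 2n with
    coefficients at most 16W. Unless it is zero, such a polynomial vanishes at 1 to
    order at most k = O(W^(1/4) sqrt n), by duality with a Fejer-like kernel built
    from Chebyshev polynomials, and so keeps a constant sign on [1 - eps, 1) with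
    1 / eps = n^O(k). Thus for lam in this interval the run is also a run for the
    discount factor 1 - eps. *)

(** * Order of vanishing at 1 *)

Section Moments.
Variable F : comNzRingType.
Implicit Types p q : {poly F}.

(** Unlike [deriv], it keeps each coefficient at its index i and multiplies it by i, so the value at
    1 of the j-th iterate is the j-th moment of the coefficients. *)
Definition euler p : {poly F} := 'X * p^`().

Lemma coef_iter_euler j p i : (iter j euler p)`_i = i%:R ^+ j * p`_i.
Proof.
elim: j => [|j IHj]; first by rewrite expr0 mul1r.
rewrite iterS coefXM; case: i IHj => [|i] IHj; first by rewrite expr0n mul0r.
by rewrite coef_deriv IHj exprS -mulrA mulr_natl.
Qed.

Lemma iter_euler_root1 k j p : (exists q, p = q * ('X - 1) ^+ (k + j)) ->
  exists q, iter j euler p = q * ('X - 1) ^+ k.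
Proof.
elim: j k p => [|j IHj] k p; first by rewrite addn0.
rewrite addnS -addSn => /IHj [q Hq].
exists ('X * (q^`() * ('X - 1) + q *+ k.+1)).
rewrite iterS Hq /euler derivM deriv_exp derivB derivX -polyC1 derivC subr0 /=.
rewrite exprS; ring.
Qed.

(** For q = X^j with j < k the sum is the value at 1 of the j-th [euler] iterate of p, which keeps a
    factor X - 1. Linearity gives the rest. *)
Lemma moment_eq0 k p q : (exists h, p = h * ('X - 1) ^+ k) -> (size q <= k)%N ->
  \sum_(i < size p) p`_i * q.[i%:R] = 0.
Proof.
move=> [h hp] sq.
have mono j : (j < k)%N -> \sum_(i < size p) p`_i * i%:R ^+ j = 0.
  move=> jk; have [|h' Hh'] := @iter_euler_root1 (k - j) j p.
    by exists h; rewrite subnK // ltnW.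
  have : (iter j euler p).[1] = 0.
    rewrite Hh' hornerM horner_exp hornerD hornerN hornerX hornerC subrr.
    by rewrite expr0n subn_eq0 leqNgt jk mulr0.
  rewrite (@horner_coef_wide _ (size p)); last first.
    by apply/leq_sizeP => i Hi; rewrite coef_iter_euler (nth_default 0 Hi) mulr0.
  move=> E; rewrite -[RHS]E; apply: eq_bigr => i _.
  by rewrite coef_iter_euler expr1n mulr1 mulrC.
under eq_bigr => i _ do rewrite horner_coef mulr_sumr.
rewrite exchange_big big1 // => j _ /=.
under eq_bigr => i _ do rewrite mulrCA.
by rewrite -mulr_sumr mono ?mulr0 // (leq_trans (ltn_ord j)).
Qed.

End Moments.

Section Chebyshev.
Variable F : realFieldType.

(* The pair of consecutive quotients S_m = (1 - T_m) / (1 - 'X), where T_m is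
   the Chebyshev polynomial; the recurrence is that of T_m divided by 1 - 'X. *)
Fixpoint chebq2 m : {poly F} * {poly F} :=
  if m is m'.+1 then
    let: (s, s') := chebq2 m' in (s', 2 *: ('X * s') - s + 2%:P)
  else (0, 1).

Definition chebq m := (chebq2 m).1.

Lemma chebqSS m : chebq m.+2 = 2 *: ('X * chebq m.+1) - chebq m + 2%:P.
Proof. by rewrite /chebq /=; case: (chebq2 m). Qed.

Lemma size_chebq m : (size (chebq m) <= m)%N.
Proof.
suff: (size (chebq m) <= m)%N /\ (size (chebq m.+1) <= m.+1)%N by case.
elim: m => [|m [IH1 IH2]]; first by rewrite size_poly0 size_poly1.
split=> //; rewrite chebqSS.
apply: leq_trans (size_polyD _ _) _; rewrite geq_max; apply/andP; split; last first.
  by apply: leq_trans (size_polyC_leq1 _) _.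
apply: leq_trans (size_polyD _ _) _; rewrite geq_max size_polyN; apply/andP; split.
  apply: leq_trans (size_scale_leq _ _) _.
  rewrite mulrC; apply: leq_trans (size_polyMleq _ _) _.
  by rewrite size_polyX addn2.
by rewrite (leq_trans IH1) // ltnW.
Qed.

Lemma horner_chebq_1 m : (chebq m).[1] = m%:R ^+ 2.
Proof.
suff: (chebq m).[1] = m%:R ^+ 2 /\ (chebq m.+1).[1] = m.+1%:R ^+ 2 by case.
elim: m => [|m [IH1 IH2]]; first by rewrite hornerC hornerC expr0n expr1n.
split=> //; rewrite chebqSS !(hornerD, hornerN, hornerZ, hornerM, hornerX, hornerC)
    IH1 IH2 -[m.+2%:R]natr1 -[m.+1%:R]natr1; ring.
Qed.

(** This amounts to |T_m(y)| <= 1. Instead of cosines, the proof uses a quadratic form in (T_k,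
    T_{k+1}) preserved by the recurrence; completing the square in it gives (1 - y^2)(1 - T_m^2) >=
    0. *)
Lemma horner_chebq_le m y : -1 < y -> y < 1 -> `|(chebq m).[y]| <= 2 / (1 - y).
Proof.
move=> y1 y2.
pose T m := 1 - (1 - y) * (chebq m).[y].
have TS k : T k.+2 = 2 * y * T k.+1 - T k.
  by rewrite /T chebqSS !(hornerD, hornerN, hornerZ, hornerM, hornerX, hornerC); ring.
have inv k : T k ^+ 2 - 2 * y * T k * T k.+1 + T k.+1 ^+ 2 = 1 - y ^+ 2.
  elim: k => [|k IHk]; first by rewrite /T !hornerC; ring.
  by rewrite TS -IHk; ring.
have Tle : T m ^+ 2 <= 1.
  have h : (T m.+1 - y * T m) ^+ 2 = (1 - y ^+ 2) * (1 - T m ^+ 2).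
    rewrite -{1}(inv m); have := inv m; set a := T m; set b := T m.+1; nra.
  have hy : 0 < 1 - y ^+ 2 by nra.
  have : 0 <= (1 - y ^+ 2) * (1 - T m ^+ 2) by rewrite -h sqr_ge0.
  by rewrite pmulr_rge0 // subr_ge0.
have hy : 0 < 1 - y by lra.
rewrite ler_pdivlMr // -(gtr0_norm hy) -normrM.
have -> : (chebq m).[y] * (1 - y) = 1 - T m by rewrite /T; ring.
rewrite ler_norml; apply/andP; split; nra.
Qed.

End Chebyshev.

(** Telescoping with 1/(a+1)^2 <= 1/a - 1/(a+1). At n = 0 the inverse is 0 by convention. *)
Lemma sum_inv_sqr_le (F : realFieldType) n :
  \sum_(i < n) (i.+1%:R ^+ 2)^-1 <= 2 - n%:R^-1 :> F.
Proof.
elim: n => [|n IHn]; first by rewrite big_ord0 invr0; lra.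
rewrite big_ord_recr /=.
case: n IHn => [|n] IHn; first by rewrite big_ord0 expr1n invr1; lra.
apply: le_trans (lerD IHn (lexx _)) _.
rewrite -lerBrDr; set a := n.+1%:R; have a1 : 1 <= a by rewrite ler1n.
have -> : n.+2%:R = a + 1 :> F by rewrite natr1.
have : ((a + 1) ^+ 2)^-1 <= a^-1 - (a + 1)^-1.
  have -> : a^-1 - (a + 1)^-1 = (a * (a + 1))^-1.
    by field; apply/andP; split; lra.
  by rewrite lef_pV2 ?posrE ?mulr_gt0 ?exprn_gt0 //; [nra | lra..].
by move: (_^-1) (_^-1) (_^-1) => x y z; lra.
Qed.

(* The test polynomial q(x) = S_m(1 - 2x/D)^2 has q(0) = m^4 and
   |q(i)| <= (D/i)^2 at i = 1, ..., D - 1, so it would violate the vanishing of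
   the moments of a polynomial with a zero of order 2m at 1. *)
Lemma mult1_lt (P h : {poly int}) (M m k : nat) :
  P != 0 -> (forall i, `|P`_i| <= M%:R) -> P = h * ('X - 1) ^+ k ->
  (2 * M * size P ^ 2 < m ^ 4)%N -> (k < 2 * m)%N.
Proof.
move=> P0 PM Ph mM; rewrite ltnNge; apply/negP => mk.
pose D := size P.
have [i0 Pi0 i0min] : exists2 i0, P`_i0 != 0 & forall i, (i < i0)%N -> P`_i = 0.
  have ex : exists i, P`_i != 0 by exists D.-1; rewrite -[_`_ _]/(lead_coef P) lead_coef_eq0.
  case: (ex_minnP ex) => i Hi imin; exists i => // j ji.
  by apply/eqP/contraT => /imin; rewrite leqNgt ji.
have i0D : (i0 < D)%N by rewrite ltnNge; apply: contra Pi0 => ?; rewrite nth_default.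
have D0 : (0 < D)%N by lia.
have DR : 0 < D%:R :> rat by rewrite ltr0n.
(* The kernel is centred at the first nonzero index [i0]; [l] maps [i0] to 1 and the later indices
   below D into (-1, 1). *)
pose l : {poly rat} := 1 - (2 / D%:R) *: ('X - i0%:R%:P).
pose q : {poly rat} := (chebq rat m \Po l) ^+ 2.
have qE x : q.[x] = (chebq rat m).[1 - 2 / D%:R * (x - i0%:R)] ^+ 2.
  by rewrite /q /l horner_exp horner_comp
    !(hornerD, hornerN, hornerZ, hornerM, hornerX, hornerC).
have sq : (size q <= k)%N.
  apply: leq_trans mk.
  have sl : (size l <= 2)%N.
    apply: leq_trans (size_polyD _ _) _.
    rewrite geq_max size_poly1 size_polyN /=.
    by apply: leq_trans (size_scale_leq _ _) _; rewrite size_XsubC.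
  have sc : (size (chebq rat m \Po l) <= m.-1.+1)%N.
    apply: leq_trans (size_comp_poly_leq _ _) _; rewrite ltnS.
    rewrite -[m.-1]muln1 leq_mul //.
      by rewrite -!subn1 leq_sub2r // size_chebq.
    by case: (size l) sl => [|[|[]]].
  rewrite /q expr2; apply: leq_trans (size_polyMleq _ _) _.
  have m0 : (0 < m)%N by case: (m) mM.
  lia.
pose PR : {poly rat} := map_poly intr P.
have sPR : size PR = D by rewrite size_map_inj_poly // => x y /intr_inj.
have := @moment_eq0 rat k PR q _ sq.
rewrite sPR => /(_ _) H.
have {H} : \sum_(i < D) PR`_i * q.[i%:R] = 0.
  apply: H; exists (map_poly intr h).
  by rewrite /PR Ph rmorphM rmorphXn rmorphB /= map_polyX rmorph1.
rewrite (bigD1 (Ordinal i0D)) //= => /eqP; rewrite addrC addr_eq0 => /eqP eq0.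
(* The moment identity isolates the term at [i0], of modulus at least m^4. Every later term is at
   most M D^2 / (i - i0)^2, and the inverse squares sum to at most 2. *)
have : `|PR`_i0 * q.[i0%:R]| <= M%:R * (2 * D%:R ^+ 2).
  rewrite -normrN -eq0.
  apply: le_trans (ler_norm_sum _ _ _) _.
  have term (i : 'I_D) : i != Ordinal i0D ->
    `|PR`_i * q.[i%:R]| <=
      M%:R * (D%:R ^+ 2 * (if (i0 < i)%N then ((i - i0)%:R ^+ 2)^-1 else 0)).
    rewrite -val_eqE /= => ii0.
    case: ifP => [lt|/negbT].
      rewrite normrM; apply: ler_pM => //.
        by rewrite coef_map /= -intr_norm (_ : M%:R = (M%:R : int)%:~R) ?ler_int // mulrz_nat.
      have hi : 0 < (i - i0)%:R :> rat by rewrite ltr0n subn_gt0.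
      have lti : (i - i0)%:R < D%:R :> rat by rewrite ltr_nat; have := ltn_ord i; lia.
      rewrite qE -natrB ?(ltnW lt) // normrX.
      set z := (i - i0)%:R in hi lti *.
      have b1 : 0 < z / D%:R by rewrite divr_gt0.
      have b2 : z / D%:R < 1 by rewrite ltr_pdivrMr // mul1r.
      have -> : 2 / D%:R * z = 2 * (z / D%:R) by ring.
      rewrite -exprVn -exprMn; apply: lerXn2r; rewrite ?nnegrE ?mulr_ge0 ?invr_ge0 ?ler0n //.
      apply: le_trans (horner_chebq_le _ _ _ _ _) _; [lra|lra|].
      have z0 : z != 0 by rewrite gt_eqF.
      have d0 : D%:R != 0 :> rat by rewrite gt_eqF.
      rewrite le_eqVlt; apply/orP; left; apply/eqP; field.
      by rewrite z0 d0 opprB addrCA subrr addr0 mulf_neq0.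
    rewrite -leqNgt leq_eqVlt (negPf ii0) /= => /i0min Pi.
    by rewrite coef_map /= Pi mul0r normr0 !mulr0.
  apply: le_trans (ler_sum _ term) _.
  rewrite -mulr_sumr ler_wpM2l // -mulr_sumr mulrC ler_wpM2r ?exprn_ge0 //.
  apply: (@le_trans _ _ (\sum_(i < D)
    (if (i0 < i)%N then ((i - i0)%:R ^+ 2)^-1 else 0 : rat))).
    rewrite [leRHS](bigD1 (Ordinal i0D)) //= lerDr.
    by case: ifP => // _; rewrite invr_ge0 exprn_ge0.
  rewrite -(big_mkord xpredT (fun i => if (i0 < i)%N then ((i - i0)%:R ^+ 2)^-1 else 0)).
  rewrite (big_cat_nat (n := i0.+1)) //= [X in X + _]big_nat_cond big1 ?add0r; last first.
    by move=> i /andP[/andP[_ ?] _]; rewrite ltnNge -ltnS; case: ifP => //; lia.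
  rewrite -[i0.+1]add0n big_addn big_mkord.
  under eq_bigr => i _.
    rewrite ifT; last by lia.
    rewrite (_ : (i + i0.+1 - i0)%N = i.+1); last by lia.
    over.
  apply: le_trans (sum_inv_sqr_le _ _) _.
  by rewrite gerBl invr_ge0.
rewrite qE subrr mulr0 subr0 horner_chebq_1 normrM.
have a1 : 1 <= `|PR`_i0|.
  by rewrite coef_map /= -intr_norm -[1]/(1%:~R) ler_int -gtz0_ge1 normr_gt0.
rewrite (ger0_norm (exprn_ge0 _ (exprn_ge0 _ _))) // -exprM => H.
have : m%:R ^+ 4 <= M%:R * (2 * D%:R ^+ 2) :> rat.
  by apply: le_trans H; rewrite ler_peMl // exprn_ge0.
rewrite -!natrX -!natrM ler_nat leqNgt => /negP; apply.
by rewrite mulnCA mulnA.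
Qed.

(** * Sign near 1 *)

Lemma coef_XD1_exp (F : nzRingType) n j : (('X + 1 : {poly F}) ^+ n)`_j = 'C(n, j)%:R.
Proof.
elim: n j => [|n IHn] j; first by rewrite expr0 coef1 bin0n eq_sym.
rewrite exprS mulrDl mul1r coefD coefXM IHn.
case: j => [|j] /=; rewrite IHn; first by rewrite add0r !bin0.
by rewrite binS natrD addrC.
Qed.

Lemma binom_le_exp n j : ('C(n, j) <= n ^ j)%N.
Proof.
elim: j n => [|j IHj] n; first by rewrite bin0.
case: n => [|n] //; apply: leq_trans (leq_pmull _ (ltn0Sn j)) _.
rewrite -mul_bin_diag expnS leq_mul // (leq_trans (IHj n)) //.
by case: j {IHj} => // j; rewrite leq_exp2r.
Qed.

(** The coefficient is the sum of the P_i 'C(i, j): at most D terms, each at most M D^j. *)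
Lemma coef_comp_XD1_le (P : {poly int}) (M D : nat) : (size P <= D)%N ->
  (forall i, `|P`_i| <= M%:R) -> forall j, `|(P \Po ('X + 1))`_j| <= (M * D ^ j.+1)%:R.
Proof.
move=> PD PM j; rewrite comp_polyE coef_sum; apply: le_trans (ler_norm_sum _ _ _) _.
apply: (@le_trans _ _ (\sum_(i < size P) (M * D ^ j)%:R)).
  apply: ler_sum => i _; rewrite coefZ coef_XD1_exp normrM natrM.
  apply: ler_pM => //; rewrite normr_nat ler_nat.
  apply: leq_trans (binom_le_exp _ _) _; case: j => [|j] //.
  by rewrite leq_exp2r // (leq_trans (ltnW (ltn_ord i))).
rewrite sumr_const card_ord -mulrnA ler_nat expnS mulnCA mulnC.
by rewrite leq_mul.
Qed.

Lemma geometric_sum_le (F : realFieldType) (z : F) n : 0 <= z -> z <= 2^-1 ->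
  \sum_(i < n) z ^+ i.+1 <= 2 * z.
Proof.
move=> z0 z2; elim: n => [|n IHn]; first by rewrite big_ord0 mulr_ge0.
rewrite big_ord_recl expr1; under eq_bigr do rewrite lift0 exprS.
by rewrite -mulr_sumr; set s := \sum_(_ < _) _ in IHn *; nra.
Qed.

Section SignNear1.
Variable R : realFieldType.
Implicit Type P : {poly int}.

Definition evalz P (x : R) : R := (map_poly intr P).[x].

(* With P = h * (X - 1)^k and h(1) <> 0, the integer |h(1)| is at least 1, and
   h stays within 1/2 of h(1) on the interval considered. *)
Lemma sign_near1 P (M D m : nat) : (0 < D)%N ->
  (size P <= D)%N -> (forall i, `|P`_i| <= M%:R) -> (2 * M * D ^ 2 < m ^ 4)%N ->
  exists s : bool, forall x, 1 - ((4 * M.+1 * D ^ (2 * m).+1)%:R)^-1 <= x -> x < 1 ->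
    (0 <= evalz P x) = s.
Proof.
move=> D0 PD PM mM.
have [->|P0] := eqVneq P 0.
  by exists true => y _ _; rewrite /evalz rmorph0 horner0 lexx.
have [k [h]] := multiplicity_XsubC P 1.
rewrite P0 /= polyC1 => h1 Ph.
have km : (k < 2 * m)%N.
  apply: mult1_lt P0 PM Ph _; apply: leq_ltn_trans mM.
  by rewrite leq_mul // leq_exp2r.
(* Taylor expansion of h at 1: its constant term is h(1), and its coefficients are those of P at 1
   shifted by k. *)
pose g := h \Po ('X + 1).
have g0 : 1 <= `|g`_0|.
  rewrite -gtz0_ge1 normr_gt0 -horner_coef0 /g horner_comp.
  by rewrite !(hornerD, hornerX, hornerC) add0r.
have gle j : `|g`_j| <= (M * D ^ (k + j).+1)%:R.
  have := @coef_comp_XD1_le P M D PD PM (k + j).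
  rewrite Ph comp_polyM rmorphXn /= (_ : ('X - 1) \Po ('X + 1) = 'X); last first.
    by rewrite comp_polyB comp_polyX -[X in X \Po _]polyC1 comp_polyC addrK.
  by rewrite coefMXn ltnNge leq_addr /= addKn.
exists (0 <= (-1) ^+ k * g`_0) => y ylo yhi.
pose e : R := 1 - y.
have e0 : 0 < e by rewrite subr_gt0.
have ele : e <= ((4 * M.+1 * D ^ (2 * m).+1)%:R)^-1 by rewrite /e lerBlDr -lerBlDl.
have -> : evalz P y = (-1) ^+ k * evalz g (- e) * e ^+ k.
  rewrite mulrAC -exprMn mulN1r mulrC /evalz {1}Ph rmorphM rmorphXn rmorphB /=.
  rewrite map_polyX rmorph1 hornerM horner_exp !(hornerD, hornerN, hornerX, hornerC).
  congr (_ * _ ^+ _); last by rewrite /e; ring.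
  rewrite /g map_comp_poly rmorphD /= map_polyX rmorph1 horner_comp.
  by rewrite !(hornerD, hornerX, hornerC) /e; congr _.[_]; ring.
rewrite pmulr_lge0 ?exprn_gt0 //.
pose K : R := (M.+1 * D ^ (2 * m).+1)%:R.
have K1 : 1 <= K by rewrite ler1n muln_gt0 expn_gt0 D0.
have K0 : 0 < 4 * K by lra.
have eK : 4 * K * e <= 1.
  by rewrite mulrC -ler_pdivlMr // div1r /K -natrM mulnA.
have DK : D%:R <= K.
  rewrite ler_nat expnS mulnCA leq_pmulr // muln_gt0 expn_gt0 D0 //.
(* The inequality k < 2m enters here and dictates the exponent 2m + 1 in the interval. *)
have KK : (M * D ^ k.+2)%:R <= K by rewrite ler_nat leq_mul // leq_pexp2l.
have close : `|evalz g (- e) - (g`_0)%:~R| <= 2^-1.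
  rewrite /evalz (@horner_coef_wide _ (size g).+1); last first.
    by rewrite (leq_trans (size_poly _ _)).
  rewrite big_ord_recl expr0 mulr1 coef_map addrAC subrr add0r.
  apply: le_trans (ler_norm_sum _ _ _) _.
  apply: (@le_trans _ _ (\sum_(i < size g) (M * D ^ k.+1)%:R * (D%:R * e) ^+ i.+1)).
    apply: ler_sum => i _; rewrite coef_map /= normrM normrX normrN (gtr0_norm e0).
    rewrite exprMn mulrA -natrX -natrM ler_wpM2r ?exprn_ge0 ?(ltW e0) //.
    rewrite -mulnA -expnD -intr_norm addSn.
    rewrite -[leRHS]mulrz_nat ler_int; exact: gle.
  have De : D%:R * e <= 2^-1.
    by apply: (@le_trans _ _ (K * e)); [rewrite ler_wpM2r // ltW | lra].
  rewrite -mulr_sumr; apply: le_trans (ler_wpM2l _ (geometric_sum_le _ _ _ _ De)) _ => //.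
    by rewrite mulr_ge0 // ltW.
  rewrite mulrCA [X in 2 * X]mulrA -natrM -mulnA -expnSr.
  have : (M * D ^ k.+2)%:R * e <= K * e by rewrite ler_wpM2r // ltW.
  by move: eK; rewrite -mulrA; lra.
have : (1 <= g`_0) || (g`_0 <= -1) by rewrite lerNr -ler_normr.
rewrite -!(ler_int R) [in RHS]rmorphM /= rmorph_sign.
move: close; set G : R := (g`_0)%:~R; set E := evalz g (- e).
rewrite ler_norml -![(-1) ^+ k]signr_odd => /andP[c1 c2] /orP[] G1;
  clearbody G E; clear -c1 c2 G1; case: (odd k); rewrite ?expr0 ?expr1 ?mul1r ?mulN1r; apply/idP/idP; lra.
Qed.

End SignNear1.

(** * Discounted payoffs *)

Section Game.
Variables (V : finType) (owner : V -> bool) (E : rel V) (R : realType).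
Variables (r : V -> V -> int) (lam : R).
Hypotheses (lam0 : 0 <= lam) (lam1 : lam < 1).
Implicit Types (s t : V -> V) (d f : V -> R).

Local Notation Disc := (@Disc V owner R r lam).
Local Notation nx := (Defs.next owner).
Local Notation q f v w := ((r v w)%:~R + lam * f w).

(** Comparison with a geometric series of ratio [lam] gives convergence, after which the first term
    splits off under the limit. *)
Lemma Disc_rec s t v : Disc s t v = q (Disc s t) v (nx s t v).
Proof.
pose c w : R := (r w (nx s t w))%:~R.
pose u v i := lam ^+ i * c (iter i (nx s t) v).
have DE w : Disc s t w = limn (series (u w)) by [].
pose B := \sum_w `|c w|.
have cB w : `|c w| <= B by rewrite /B (bigD1 w) //= lerDl sumr_ge0.
have cu w : cvgn (series (u w)).
  apply: normed_cvg.
  apply: (@series_le_cvg _ _ (geometric B lam)) => [i|i|i|].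
  - exact: normr_ge0.
  - by rewrite /geometric /= mulr_ge0 ?exprn_ge0 ?sumr_ge0.
  - by rewrite /geometric /u /= normrM ger0_norm ?exprn_ge0 // mulrC ler_wpM2r ?exprn_ge0.
  - by apply: is_cvg_geometric_series; rewrite ger0_norm.
rewrite {1}DE; apply/cvg_lim => //.
rewrite -cvg_shiftS.
rewrite (_ : [sequence _]_n = (fun n => c v + lam * series (u (nx s t v)) n)).
  apply: cvgD; first exact: cvg_cst.
  by rewrite DE; apply: cvgM; [exact: cvg_cst | exact: cu].
apply/funext => n /=; rewrite !seriesEord /= big_ord_recl /u expr0 mul1r.
rewrite mulr_sumr; congr (_ + _); apply: eq_bigr => i _.
by rewrite [LHS](_ : _ = lam ^+ i.+1 * c (iter i.+1 (nx s t) v)) // exprS -mulrA iterSr.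
Qed.

(** Comparison principle: at a maximum x of d, a positive d(x) would satisfy d(x) <= lam d(x) <
    d(x). *)
Lemma subsolution_le0 (g : V -> V) d : (forall v, d v <= lam * d (g v)) -> forall v, d v <= 0.
Proof.
move=> H v; pose x := [arg max_(i > v) d i]%O.
have xmax w : d w <= d x.
  by rewrite /x; case: arg_maxP => // y _ /(_ w); apply.
apply: le_trans (xmax v) _.
rewrite leNgt; apply/negP => dx.
have : d x <= lam * d x by rewrite (le_trans (H x)) // ler_wpM2l.
by rewrite leNgt -[ltRHS]mul1r ltr_pM2r // lam1.
Qed.

Lemma le_Disc s t f : (forall v, f v <= q f v (nx s t v)) -> forall v, f v <= Disc s t v.
Proof.
move=> H v; rewrite -subr_le0.
apply: (@subsolution_le0 (nx s t) (fun v => f v - Disc s t v)) => w.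
by rewrite Disc_rec; have := H w; lra.
Qed.

Lemma Disc_le s t f : (forall v, q f v (nx s t v) <= f v) -> forall v, Disc s t v <= f v.
Proof.
move=> H v; rewrite -subr_le0.
apply: (@subsolution_le0 (nx s t) (fun v => Disc s t v - f v)) => w.
by rewrite Disc_rec; have := H w; lra.
Qed.

(** Otherwise switching [t] to w at v alone would do no worse anywhere and strictly better at v. *)
Lemma best_response_le s t v w : best_response owner E r lam s t ->
  ~~ owner v -> E v w -> Disc s t v <= q (Disc s t) v w.
Proof.
move=> [st Hst] ov Evw; rewrite leNgt; apply/negP => lt.
pose t' x := if x == v then w else t x.
have st' : strat2 owner E t'.
  by move=> x ox; rewrite /t'; case: eqP => [->//|_]; exact: st.
have le x : Disc s t' x <= Disc s t x.
  apply: Disc_le => y; rewrite /Defs.next /t'; case: ifP => oy.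
    by rewrite [leRHS]Disc_rec /Defs.next oy.
  case: eqP => [->|_]; first exact: ltW.
  by rewrite [leRHS]Disc_rec /Defs.next oy.
have := Hst _ st' v; rewrite leNgt => /negP; apply.
have nxv : nx s t' v = w by rewrite /Defs.next (negPf ov) /t' eqxx.
rewrite Disc_rec nxv.
by apply: le_lt_trans lt; rewrite lerD2l ler_wpM2l.
Qed.

(** The default of [odflt] is never reached, since a maximum over the nonempty set of successors
    exists. *)
Lemma bellmanP f v : game_ok E -> owner v ->
  E v (bellman owner E r lam f v) /\
  forall w, E v w -> q f v w <= q f v (bellman owner E r lam f v).
Proof.
move=> ok ov; rewrite /bellman ov; have [u0 Eu0] := ok v.
case: pickP => [u /andP[Eu /forallP Hu]|none] /=.
  by split=> // w Ew; have := Hu w; rewrite Ew.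
have := none [arg max_(u > u0 | E v u) q f v u]%O.
case: arg_maxP => // i Ei imax; rewrite Ei => /negP[].
by apply/forallP => w; apply/implyP => /imax.
Qed.

End Game.

(** * Strategy iteration *)

Section StrategyIteration.
Variables (V : finType) (owner : V -> bool) (E : rel V) (R : realType).
Variables (r : V -> V -> int) (lam : R).
Hypotheses (lam0 : 0 <= lam) (lam1 : lam < 1).
Variables (s0 : V -> V) (sig tau : nat -> V -> V).
Hypotheses (Eok : game_ok E) (s0ok : strat1 owner E s0).
Hypothesis run : SI_run owner E r lam s0 sig tau.

Local Notation Disc := (@Disc V owner R r lam).
Local Notation q f v w := ((r v w)%:~R + lam * f w).

Let W k := Disc (sig k) (tau k).

Let sig_bellman k : sig k.+1 = bellman owner E r lam (W k).
Proof. by case: run. Qed.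

Let tau_best k : best_response owner E r lam (sig k) (tau k).
Proof. by case: run. Qed.

Lemma SI_strat1 k : strat1 owner E (sig k).
Proof.
case: k => [|k]; first by case: run => ->.
by move=> v ov; rewrite sig_bellman; case: (bellmanP _ _ _ _ r lam (W k) v Eok ov).
Qed.

Let tau_strat2 k : strat2 owner E (tau k).
Proof. by case: (tau_best k). Qed.

Let W_own k v : owner v -> W k v = q (W k) v (sig k v).
Proof. by move=> ov; rewrite {1}/W Disc_rec // /Defs.next ov. Qed.

Let W_opp k v : ~~ owner v -> W k v = q (W k) v (tau k v).
Proof. by move=> ov; rewrite {1}/W Disc_rec // /Defs.next (negPf ov). Qed.

Let W_opp_le k v w : ~~ owner v -> E v w -> W k v <= q (W k) v w.
Proof. exact: best_response_le. Qed.

Let W_greedy k v w : owner v -> E v w -> q (W k) v w <= q (W k) v (sig k.+1 v).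
Proof.
move=> ov Ew; rewrite sig_bellman.
by case: (bellmanP _ _ _ _ r lam (W k) v Eok ov) => _; apply.
Qed.

(** [W k] is a subsolution for the next pair of strategies: the greedy move beats the old one, and
    no legal player-2 move goes below a best response. *)
Let W_mono k v : W k v <= W k.+1 v.
Proof.
apply: le_Disc => // w; rewrite /Defs.next; case: ifP => ow.
  by rewrite W_own // W_greedy // SI_strat1.
by rewrite W_opp_le ?ow // tau_strat2 ?ow.
Qed.

Let W_homo i j v : (i <= j)%N -> W i v <= W j v.
Proof. by move=> /subnK <-; elim: (j - i)%N => // n IH; apply: le_trans IH (W_mono _ _). Qed.

Let W_stable k : W k.+1 =1 W k -> sig k.+2 = sig k.+1.
Proof. by move=> /funext e; rewrite !sig_bellman e. Qed.

(** Best responses give the matching inequality at player-2 vertices, so this makes [W k] a solution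
    of the optimality equations. *)
Definition own_optimal k := forall v w, owner v -> E v w -> q (W k) v w <= W k v.

Lemma own_optimal_stop k : eq_strat1 owner (sig k.+1) (sig k) -> own_optimal k.
Proof. by move=> e v w ov Ew; rewrite [leRHS]W_own // -e // W_greedy. Qed.

Lemma own_optimal_value k : W k.+1 =1 W k -> own_optimal k.
Proof. by move=> e v w ov Ew; rewrite -[leRHS]e [leRHS]W_own // (e (sig k.+1 v)) W_greedy. Qed.

Lemma own_optimal_max k s v : own_optimal k -> strat1 owner E s ->
  Disc s (tau k) v <= W k v.
Proof.
move=> ok ss; apply: Disc_le => // w; rewrite /Defs.next; case: ifP => ow.
  by rewrite ok // ss.
by rewrite [leRHS]W_opp ?ow.
Qed.

Lemma SI_stop_optimal k : eq_strat1 owner (sig k.+1) (sig k) ->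
  optimal owner E r lam (sig k).
Proof.
move=> /own_optimal_stop ok; split=> [|v s' ss']; first exact: SI_strat1.
exists (tau k); split=> // t' st'.
by apply: le_trans (own_optimal_max k s' v ok ss') _; case: (tau_best k) => _; apply.
Qed.

(** Purely qualitative: some strategy recurs among finitely many, and its value cannot have grown in
    between. It only supplies the optimal vector against which progress is measured. *)
Lemma exists_own_optimal : exists k, own_optimal k.
Proof.
pose S : 'I_(#|{ffun V -> V}|.+1) -> {ffun V -> V} := fun i => [ffun v => sig i v].
have /injectivePn[i [j ij Sij]] : ~~ injectiveb S.
  by apply/negP => /injectiveP /leq_card; rewrite card_ord ltnn.
wlog lt : i j ij Sij / (i < j)%N.
  move=> H; have := ij; rewrite -val_eqE neq_ltn => /orP[|] lt.
    exact: (H i j).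
  by apply: (H j i) => //; rewrite eq_sym.
exists i; apply: own_optimal_value => v; apply/le_anti; rewrite W_mono andbT.
apply: le_trans (W_homo _ _ v lt) _.
have -> : W i v = Disc (sig j) (tau i) v.
  by congr Defs.Disc; apply/funext => w; move/ffunP: Sij => /(_ w); rewrite !ffunE.
by case: (tau_best j) => _; apply.
Qed.

(** * Convergence rate towards the optimal values *)

Section Optimum.
Variables (j : nat) (jopt : own_optimal j).
Let X := W j.

Let W_le_opt k v : W k v <= X v.
Proof.
apply: le_trans (own_optimal_max j (sig k) v jopt (SI_strat1 k)).
by case: (tau_best k) => _; apply.
Qed.

(** One iteration gains at least as much as a step of value iteration, which is a contraction of
    ratio [lam]. *)
Let contract k c : (forall v, X v - W k v <= c) -> forall v, X v - W k.+1 v <= lam * c.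
Proof.
move=> H v; case ov : (owner v).
  have Ev := SI_strat1 j v ov.
  have := W_greedy k v _ ov Ev; have := W_own j v ov; rewrite -/X.
  have := W_own k.+1 v ov.
  have : lam * (X (sig j v) - W k (sig j v)) <= lam * c by rewrite ler_wpM2l.
  have : lam * W k (sig k.+1 v) <= lam * W k.+1 (sig k.+1 v) by rewrite ler_wpM2l.
  by rewrite mulrBr; lra.
have {}ov := negbT ov; have Ev := tau_strat2 k.+1 v ov.
have := W_opp_le j v _ ov Ev; rewrite -/X; have := W_opp k.+1 v ov.
have : lam * (X (tau k.+1 v) - W k (tau k.+1 v)) <= lam * c by rewrite ler_wpM2l.
have : lam * W k (tau k.+1 v) <= lam * W k.+1 (tau k.+1 v) by rewrite ler_wpM2l.
by rewrite mulrBr; lra.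
Qed.

Let contractn n k c : (forall v, X v - W k v <= c) ->
  forall v, X v - W (n + k)%N v <= lam ^+ n * c.
Proof.
move=> H; elim: n => [|n IHn] v; first by rewrite mul1r.
by rewrite exprS -mulrA; apply: contract.
Qed.

(** Reduced cost, with respect to the optimum, of the edge chosen at v. It depends on k only through
    that edge. *)
Let loss k v := X v - q X v (sig k v).

Let loss_le k v : owner v -> loss k v <= X v - W k v.
Proof. by move=> ov; rewrite W_own // lerB // lerD2l ler_wpM2l. Qed.

(** A loss of at most a per move adds up to at most a (1 + lam + lam^2 + ...). *)
Let gap_le k a : 0 <= a -> (forall v, owner v -> loss k v <= a) ->
  forall v, X v - W k v <= a / (1 - lam).
Proof.
move=> a0 H v; have l1 : 0 < 1 - lam by rewrite subr_gt0.
rewrite -subr_le0; set c := a / (1 - lam).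
have ac : a = c - lam * c by rewrite /c; field; rewrite gt_eqF.
clearbody c.
apply: (@subsolution_le0 _ _ lam _ _ (Defs.next owner (sig k) (tau k))
  (fun v => X v - W k v - c)) => // w.
rewrite /Defs.next; case: ifP => ow.
  by have := H w ow; rewrite /loss (W_own k w ow); lra.
have {}ow := negbT ow; have := W_opp_le j w _ ow (tau_strat2 k w ow).
by rewrite (W_opp k w ow) -/X; lra.
Qed.

(** Take the player-1 vertex of largest loss. If its edge came back after L steps, the same loss
    would be bounded by a gap contracted by lam^L < 1 - lam, hence by less than itself. *)
Lemma eliminated_edge L k : lam ^+ L < 1 - lam -> ~ (W k =1 X) ->
  exists2 v, owner v & forall i, (L + k <= i)%N -> sig i v != sig k v.
Proof.
move=> lamL neq.
have [v0 lt0] : exists v, W k v < X v.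
  apply: contrapT => none; apply: neq => v; apply/le_anti; rewrite W_le_opt /=.
  by rewrite leNgt; apply/negP => lt; apply: none; exists v.
have [u0 ou0 lu0] : exists2 u, owner u & 0 < loss k u.
  apply: contrapT => none.
  have := gap_le k 0 (lexx _) _ v0; rewrite mul0r => /(_ _) H.
  have : X v0 - W k v0 <= 0.
    by apply: H => v ov; rewrite leNgt; apply/negP => lt; apply: none; exists v.
  by lra.
pose u := [arg max_(i > u0 | owner i) loss k i]%O.
have [ou umax] : owner u /\ forall i, owner i -> loss k i <= loss k u.
  by rewrite /u; case: arg_maxP => // i oi imax; split=> // x; exact: imax.
have lu : 0 < loss k u by apply: lt_le_trans lu0 (umax _ ou0).
exists u => // i; rewrite leq_eqVlt => Li; apply/eqP => eqs.
have : loss k u <= lam ^+ (i - k) * (loss k u / (1 - lam)).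
  have -> : loss k u = loss i u by rewrite /loss eqs.
  apply: le_trans (loss_le i u ou) _.
  have ki : (i - k + k)%N = i by rewrite subnK //; lia.
  rewrite -{1}ki; have -> : loss i u = loss k u by rewrite /loss eqs.
  exact: contractn (gap_le _ _ (ltW lu) umax) _.
have l1 : 0 < 1 - lam by rewrite subr_gt0.
rewrite leNgt => /negP; apply; rewrite mulrCA -[ltRHS]mulr1 ltr_pM2l //.
rewrite ltr_pdivrMr // mul1r; apply: le_lt_trans lamL.
by rewrite ler_wiXn2l // ?ltW //; lia.
Qed.

(** Until the optimum is reached, each block of L iterations eliminates a new pair (vertex,
    successor), and there are only n^2 pairs. *)
Lemma optimum_reached L : lam ^+ L < 1 - lam -> W (#|V| ^ 2 * L)%N =1 X.
Proof.
move=> lamL; apply: contrapT => neq.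
have neqi i : (i <= #|V| ^ 2)%N -> ~ (W (i * L)%N =1 X).
  move=> le H; apply: neq => v; apply/le_anti; rewrite W_le_opt /= -H.
  by rewrite W_homo // leq_mul.
have /choice[u Hu] : forall i : 'I_(#|V| ^ 2).+1, exists v, owner v /\
    forall i', (L + i * L <= i')%N -> sig i' v != sig (i * L)%N v.
  move=> i; have [|v ov Hv] := eliminated_edge L (i * L)%N lamL; last by exists v.
  by apply: neqi; rewrite -ltnS.
pose e (i : 'I_(#|V| ^ 2).+1) := (u i, sig (i * L)%N (u i)).
have /injectivePn[i [i' ii' eii']] : ~~ injectiveb e.
  by apply/negP => /injectiveP /leq_card; rewrite card_ord card_prod -mulnn ltnn.
wlog lt : i i' ii' eii' / (i < i')%N.
  move=> H; have := ii'; rewrite -val_eqE neq_ltn => /orP[|] lt.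
    exact: (H i i').
  by apply: (H i' i) => //; rewrite eq_sym.
case: eii' => e1 e2; have [_ /(_ (i' * L)%N)] := Hu i.
rewrite -mulSn leq_mul // => /(_ isT) /eqP; apply.
by rewrite e2 e1.
Qed.

End Optimum.

Lemma SI_stop_bound L : lam ^+ L < 1 - lam ->
  exists2 K, (K <= (#|V| ^ 2 * L).+1)%N & sig K.+1 = sig K.
Proof.
move=> lamL; have [j jopt] := exists_own_optimal.
have H := optimum_reached j jopt L lamL.
(* Once the values are optimal, tie-breaking may still change the strategy once; the next two
   strategies are greedy for the same vector. *)
exists (#|V| ^ 2 * L).+1 => //; apply: W_stable => v; apply/le_anti; rewrite W_mono andbT.
rewrite H; apply: le_trans (own_optimal_max j _ v jopt (SI_strat1 _)).
by case: (tau_best (#|V| ^ 2 * L).+1) => _; apply.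
Qed.

End StrategyIteration.

(** * Dependence on the discount factor *)

Section Transfer.
Variables (V : finType) (owner : V -> bool) (E : rel V) (R : realType).
Variable (r : V -> V -> int).
Implicit Types (s t : V -> V) (F G : R -> R).

Local Notation Disc := (@Disc V owner R r).
Local Notation W := (maxabs E r).
Local Notation n := #|V|.

Lemma reward_le v u : E v u -> `|r v u| <= W%:R.
Proof.
move=> Evu; rewrite natz -abszE lez_nat.
exact: (leq_bigmax_cond (F := fun p : V * V => `|r p.1 p.2|%N) (v, u)).
Qed.

(* Rational functions of the discount factor of the form N(x) / (1 - x^b), as
   produced by a lasso with a cycle of length b. *)
Definition lasso_form F := exists b, exists N : {poly int},
  [/\ (0 < b)%N, (b <= n)%N, (size N <= n.+1)%N, (forall i, `|N`_i| <= (4 * W)%:R) &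
      forall x, 0 <= x -> x < 1 -> (1 - x ^+ b) * F x = evalz R N x].

Lemma evalz_poly m (c : nat -> int) x :
  evalz R (\poly_(l < m) c l) x = \sum_(l < m) x ^+ l * (c l)%:~R.
Proof.
rewrite /evalz (@horner_coef_wide _ m) ?(leq_trans (size_poly _ _)) ?size_poly //.
by apply: eq_bigr => l _; rewrite coef_map coef_poly ltn_ord mulrC.
Qed.

Lemma Disc_unfold s t x m v : 0 <= x -> x < 1 ->
  Disc x s t v = \sum_(l < m) x ^+ l * (r (play owner s t v l) (play owner s t v l.+1))%:~R
                 + x ^+ m * Disc x s t (play owner s t v m).
Proof.
move=> x0 x1; elim: m => [|m IHm]; first by rewrite big_ord0 add0r mul1r.
by rewrite IHm big_ord_recr /= -addrA; congr (_ + _); rewrite Disc_rec // exprSr; ring.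
Qed.

Lemma play_edge s t v i : strat1 owner E s -> strat2 owner E t ->
  E (play owner s t v i) (play owner s t v i.+1).
Proof.
move=> ss st; rewrite /play iterS {2}/Defs.next; case: ifP => o; first exact: ss.
by apply: st; rewrite o.
Qed.

(** The play is at the same vertex at times a and o = a + b. Unfolding the payoff up to o, and up to
    a with weight x^b, leaves the same tail, which cancels in the difference. *)
Lemma Disc_numerator s t v : strat1 owner E s -> strat2 owner E t ->
  exists b, exists N : {poly int},
  [/\ (0 < b)%N, (b <= n)%N, (size N <= n)%N, (forall i, `|N`_i| <= (2 * W)%:R) &
      forall x, 0 <= x -> x < 1 -> (1 - x ^+ b) * Disc x s t v = evalz R N x].
Proof.
move=> ss st; pose f := Defs.next owner s t; pose p i := play owner s t v i.
pose c l := r (p l) (p l.+1).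
have cW l : `|c l| <= W%:R by apply/reward_le/play_edge.
have /trajectP[a lt pa] := looping_order f v.
pose o := fingraph.order f v; pose b := (o - a)%N.
have oE : (a + b)%N = o by rewrite /b subnKC // ltnW.
have on : (o <= n)%N by apply: max_card.
have polyW m i : `|(\poly_(l < m) c l)`_i| <= W%:R.
  by rewrite coef_poly; case: ifP => // _; rewrite normr0.
exists b, (\poly_(l < o) c l - (\poly_(l < a) c l) * 'X^b); split.
- by rewrite subn_gt0.
- by rewrite (leq_trans (leq_subr _ _)).
- apply: leq_trans (size_polyD _ _) _; rewrite geq_max size_polyN; apply/andP; split.
    by rewrite (leq_trans (size_poly _ _)).
  apply: leq_trans (size_polyMleq _ _) _; rewrite size_polyXn.
  by rewrite addnS (leq_trans _ on) // -oE leq_add2r size_poly.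
- move=> i; rewrite coefB coefMXn; apply: le_trans (ler_normB _ _) _.
  rewrite mul2n -addnn natrD lerD //; case: ifP => // _; rewrite normr0 //.
move=> x x0 x1.
rewrite /evalz rmorphB rmorphM /= map_polyXn hornerD hornerN hornerM hornerXn.
rewrite -/(evalz R _ x) -/(evalz R (\poly_(l < a) _) x) !evalz_poly.
have := Disc_unfold s t x o v x0 x1; have := Disc_unfold s t x a v x0 x1.
rewrite [play owner s t v o](_ : _ = play owner s t v a); last exact: pa.
rewrite -oE addnC.
by rewrite exprD mulrBl mul1r => Ea Eo; rewrite {1}Eo Ea /c /p; ring.
Qed.

Lemma lasso_Disc s t v : strat1 owner E s -> strat2 owner E t ->
  lasso_form (fun x => Disc x s t v).
Proof.
move=> ss st; have [b [N [b0 bn sN NW H]]] := Disc_numerator s t v ss st.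
exists b, N; split=> //; first by rewrite (leq_trans sN).
by move=> i; apply: le_trans (NW i) _; rewrite ler_nat leq_mul.
Qed.

(** These are the quantities compared by [bellman]. The reward contributes r (1 - X^b) to the
    numerator, and the shift costs one degree, whence the constants of [lasso_form]. *)
Lemma lasso_step s t v u : strat1 owner E s -> strat2 owner E t -> E v u ->
  lasso_form (fun x => (r v u)%:~R + x * Disc x s t u).
Proof.
move=> ss st Evu; have [b [N [b0 bn sN NW H]]] := Disc_numerator s t u ss st.
have rW := reward_le v u Evu.
exists b, ((r v u)%:P - (r v u)%:P * 'X^b + N * 'X); split=> //.
- apply: leq_trans (size_polyD _ _) _; rewrite geq_max; apply/andP; split; last first.
    by apply: leq_trans (size_polyMleq _ _) _; rewrite size_polyX addn2 ltnS.
  apply: leq_trans (size_polyD _ _) _; rewrite geq_max size_polyN; apply/andP; split.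
    by rewrite (leq_trans (size_polyC_leq1 _)).
  apply: leq_trans (size_polyMleq _ _) _; rewrite size_polyXn.
  by rewrite addnS /= -[n.+1]add1n leq_add // size_polyC_leq1.
- move=> i; rewrite coefD coefB coefMXn coefMX !coefC.
  rewrite (_ : (4 * W)%:R = W%:R + W%:R + (2 * W)%:R :> int);
    last by rewrite -!natrD; congr _%:R; lia.
  apply: le_trans (ler_normD _ _) _; apply: lerD.
    apply: le_trans (ler_normB _ _) _; apply: lerD.
      by case: ifP => // _; rewrite normr0.
    by do 2?[case: ifP => // _]; rewrite normr0.
  by case: ifP => // _; rewrite normr0.
move=> x x0 x1.
rewrite /evalz !(rmorphD, rmorphN, rmorphM) /= map_polyXn map_polyX map_polyC /=.
rewrite !(hornerD, hornerN, hornerM, hornerXn, hornerX, hornerC).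
by rewrite -/(evalz R N x) -H //; ring.
Qed.

(** Cross-multiplication by the denominators 1 - x^b and 1 - x^b', positive on [0, 1). *)
Lemma lasso_compare F G : lasso_form F -> lasso_form G ->
  exists P : {poly int}, [/\ (size P <= (2 * n).+1)%N, (forall i, `|P`_i| <= (16 * W)%:R) &
    forall x, 0 <= x -> x < 1 -> (F x <= G x) = (0 <= evalz R P x)].
Proof.
move=> [b [N [b0 bn sN NW H]]] [b' [N' [b'0 b'n sN' NW' H']]].
have sz (Q : {poly int}) k : (size Q <= n.+1)%N -> (k <= n)%N ->
    (size (Q - Q * 'X^k)%R <= (2 * n).+1)%N.
  move=> sQ kn; apply: leq_trans (size_polyD _ _) _; rewrite geq_max size_polyN.
  apply/andP; split; first by rewrite (leq_trans sQ) // ltnS leq_pmull.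
  apply: leq_trans (size_polyMleq _ _) _; rewrite size_polyXn.
  by rewrite addnS /= mul2n -addnn -addSn leq_add.
have cf (Q : {poly int}) k : (forall i, `|Q`_i| <= (4 * W)%:R) ->
    forall i, `|(Q - Q * 'X^k)`_i| <= (8 * W)%:R.
  move=> QW i; rewrite coefB coefMXn; apply: le_trans (ler_normB _ _) _.
  rewrite (_ : (8 * W)%:R = (4 * W)%:R + (4 * W)%:R :> int);
    last by rewrite -!natrD; congr _%:R; lia.
  by apply: lerD => //; case: ifP => // _; rewrite normr0.
exists ((N' - N' * 'X^b) - (N - N * 'X^b')); split.
- by apply: leq_trans (size_polyD _ _) _; rewrite geq_max size_polyN !sz.
- move=> i; rewrite coefB; apply: le_trans (ler_normB _ _) _.
  rewrite (_ : (16 * W)%:R = (8 * W)%:R + (8 * W)%:R :> int);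
    last by rewrite -!natrD; congr _%:R; lia.
  by apply: lerD; apply: cf.
move=> x x0 x1.
rewrite /evalz !(rmorphD, rmorphN, rmorphM) /= !map_polyXn.
rewrite !(hornerD, hornerN, hornerM, hornerXn) -/(evalz R N x) -/(evalz R N' x).
rewrite -H // -H' // -subr_ge0.
rewrite (_ : _ - (_ - _) = (1 - x ^+ b) * (1 - x ^+ b') * (G x - F x)); last by ring.
by rewrite pmulr_rge0 // mulr_gt0 // subr_gt0 exprn_ilt1 // -lt0n.
Qed.

(** * Runs for two discount factors near 1 *)

Section Near1.
Variables (m : nat) (x y : R).
Hypothesis mW : (2 * (16 * W) * (2 * n).+1 ^ 2 < m ^ 4)%N.
Let eps : R := ((4 * (16 * W).+1 * (2 * n).+1 ^ (2 * m).+1)%:R)^-1.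
Hypotheses (x0 : 0 <= x) (xlo : 1 - eps <= x) (x1 : x < 1).
Hypotheses (y0 : 0 <= y) (ylo : 1 - eps <= y) (y1 : y < 1).

Lemma lasso_le F G : lasso_form F -> lasso_form G -> (F x <= G x) = (F y <= G y).
Proof.
move=> lF lG; have [P [sP PW H]] := lasso_compare F G lF lG.
have [b Hb] := @sign_near1 R P _ _ m (ltn0Sn (2 * n)) sP PW mW.
by rewrite !H // !Hb.
Qed.

Lemma best_response_transfer s t : strat1 owner E s ->
  best_response owner E r x s t -> best_response owner E r y s t.
Proof.
move=> ss [st Hst]; split=> // t' st' v.
by rewrite -(lasso_le _ _ (lasso_Disc s t v ss st) (lasso_Disc s t' v ss st')) Hst.
Qed.

(** All non-strict comparisons agree at x and y, hence so do the ties, and [pick] selects the same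
    vertex. *)
Lemma bellman_transfer s t : strat1 owner E s -> strat2 owner E t ->
  bellman owner E r x (Disc x s t) = bellman owner E r y (Disc y s t).
Proof.
move=> ss st; apply/funext => v; rewrite /bellman.
case: (owner v); congr odflt; apply: eq_pick => u /=; case Eu : (E v u) => //=;
  apply: eq_forallb => w; case Ew : (E v w) => //=.
- exact: (lasso_le _ _ (lasso_step s t v w ss st Ew) (lasso_step s t v u ss st Eu)).
- exact: (lasso_le _ _ (lasso_step s t v u ss st Eu) (lasso_step s t v w ss st Ew)).
Qed.

Lemma SI_run_transfer s0 sig tau : game_ok E -> strat1 owner E s0 ->
  SI_run owner E r x s0 sig tau -> SI_run owner E r y s0 sig tau.
Proof.
move=> Eok ss0 run; have ss := SI_strat1 _ _ _ _ _ _ _ _ _ Eok ss0 run.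
have [r0 rb rs] := run; split=> // k; first exact: best_response_transfer.
by rewrite rs bellman_transfer //; case: (rb k).
Qed.

End Near1.

End Transfer.

(** * Number of iterations *)

(** For d = 1 - x, Bernoulli gives x^L <= 1 / (1 + L d), which is below d when L = N^2 since N d >=
    1. Such a crude L only affects the constant in the final exponent. *)
Lemma pow_sqr_lt (R : realFieldType) (x : R) (N : nat) : (0 < N)%N ->
  0 <= x -> x <= 1 - N%:R^-1 -> x ^+ (N ^ 2) < 1 - x.
Proof.
move=> N0 x0 xN; have NR : 0 < N%:R :> R by rewrite ltr0n.
pose d := 1 - x; have dN : N%:R^-1 <= d by rewrite /d lerBrDr -lerBrDl.
have d0 : 0 < d by apply: lt_le_trans dN; rewrite invr_gt0.
have bern L : x ^+ L * (1 + L%:R * d) <= 1.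
  elim: L => [|L IHL]; first by rewrite mul0r addr0 mulr1.
  apply: le_trans IHL; rewrite exprSr -mulrA ler_wpM2l ?exprn_ge0 //.
  have -> : x = 1 - d by rewrite /d; ring.
  rewrite -natr1; have := ler0n R L; nra.
rewrite -/d ltNge; apply/negP => le.
have Nd : 1 <= (N ^ 2)%:R * d ^+ 2.
  by rewrite natrX -exprMn expr_ge1 ?mulr_ge0 ?(ltW d0) // -ler_pdivrMl // mulr1.
have := bern (N ^ 2)%N; apply/negP; rewrite -ltNge.
have p0 : 0 <= (N ^ 2)%:R * d by rewrite mulr_ge0 // ltW.
apply: lt_le_trans (_ : d * (1 + (N ^ 2)%:R * d) <= _); last by rewrite ler_wpM2r // addr_ge0.
by rewrite mulrDr mulr1 mulrCA -expr2; lra.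
Qed.

Lemma steps_le_pow (n m W N : nat) : (2 <= n)%N ->
  (32 * W * (2 * n).+1 ^ 2 < m ^ 4)%N ->
  N = (4 * (16 * W).+1 * (2 * n).+1 ^ (2 * m).+1)%N ->
  ((n ^ 2 * N ^ 2).+2 <= n ^ (20 * m + 13))%N.
Proof.
move=> n2 mW ->.
have m0 : (0 < m)%N by case: (m) mW.
have n0 : (0 < n)%N by apply: ltn_trans n2.
(* The choice of m absorbs W: 16 W + 1 <= m^4, and m <= n^m. *)
have W1 : ((16 * W).+1 <= n ^ (4 * m))%N.
  apply: (@leq_trans (m ^ 4)); last first.
    rewrite mulnC expnM leq_exp2r //.
    by rewrite (leq_trans (ltnW (ltn_expl m (ltnSn 1)))) // leq_exp2r.
  apply: leq_ltn_trans mW; apply: (@leq_trans (32 * W)); first by rewrite leq_mul.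
  by rewrite leq_pmulr // expn_gt0.
have D1 : ((2 * n).+1 <= n ^ 3)%N by rewrite !expnS expn0; nia.
have N1 : (4 * (16 * W).+1 * (2 * n).+1 ^ (2 * m).+1 <= n ^ (10 * m + 5))%N.
  have -> : (10 * m + 5 = 2 + 4 * m + 3 * (2 * m).+1)%N by lia.
  rewrite expnD [(n ^ (2 + _))%N]expnD [(n ^ (3 * _))%N]expnM.
  apply: leq_mul; last by rewrite leq_exp2r.
  by apply: leq_mul => //; rewrite -mulnn; nia.
apply: (@leq_trans (n ^ 2 * (n ^ (10 * m + 5)) ^ 2).+2).
  by rewrite !ltnS leq_mul // leq_exp2r.
rewrite -expnM -expnD (_ : (2 + (10 * m + 5) * 2 = (20 * m + 12))%N); last by lia.
rewrite [(20 * m + 13)%N](addnS _ 12) expnS; set A := (n ^ (20 * m + 12))%N.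
have : (2 <= A)%N.
  by rewrite /A (leq_trans n2) // -[X in (X <= _)%N]expn1 leq_exp2l // addnS.
nia.
Qed.

Theorem theorem3p2 (R : realType) :
  exists C : nat,
  forall (V : finType) (owner : V -> bool) (E : rel V) (r : V -> V -> int)
         (lam : R) (s0 : V -> V) (sig tau : nat -> V -> V),
    (0 < #|V|)%N ->
    game_ok E ->
    0 <= lam -> lam < 1 ->
    strat1 owner E s0 ->
    SI_run owner E r lam s0 sig tau ->
    exists K : nat,
      [/\ (K.+1)%:R <= (#|V|%:R : R) `^ (C%:R * (1 + (maxabs E r)%:R `^ (4%:R^-1)
                                                     * Num.sqrt (#|V|%:R))),
          eq_strat1 owner (sig K.+1) (sig K),
          (forall k, (k < K)%N -> ~ eq_strat1 owner (sig k.+1) (sig k)) &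
          optimal owner E r lam (sig K)].
Proof.
(* The final exponent is 20 m + 13 with m <= 1 + 5 z, that is, at most 33 + 100 z. *)
exists 100%N => V owner E r lam s0 sig tau V0 Eok lam0 lam1 ss0 run.
have opt := @SI_stop_optimal V owner E R r lam lam0 lam1 s0 sig tau Eok ss0 run.
set n := #|V| in V0 *; set W := maxabs E r.
(* For n = 1 the bound is 1, so the run must stop at once, which it does as all strategies
   coincide. *)
have [n1|n2] := leqP n 1.
  exists 0%N.
  have e0 : eq_strat1 owner (sig 1%N) (sig 0%N) by move=> v _; apply: (fintype_le1P n1).
  split=> //; last exact: opt.
  by rewrite (_ : n = 1%N) ?powR1 //; apply/eqP; rewrite eqn_leq n1.
have exm : exists m, (32 * W * (2 * n).+1 ^ 2 < m ^ 4)%N.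
  exists (32 * W * (2 * n).+1 ^ 2).+1; apply: leq_trans (ltnSn _) _.
  by rewrite -[X in (X <= _)%N]expn1 leq_pexp2l.
case: (ex_minnP exm) => m mW mmin.
pose N := (4 * (16 * W).+1 * (2 * n).+1 ^ (2 * m).+1)%N.
have N0 : (0 < N)%N by rewrite !muln_gt0 expn_gt0.
pose e : R := N%:R^-1.
have e0 : 0 < e by rewrite invr_gt0 ltr0n.
have e1 : e <= 1 by rewrite invf_le1 ?ltr0n // ler1n.
(* The iterations are counted for [mu], which is [lam] or 1 - e. The sequence [sig] is the same, so
   optimality is still read off at [lam]. *)
have [mu [mu0 mue mu1 run']] : exists mu : R,
    [/\ 0 <= mu, mu <= 1 - e, mu < 1 & SI_run owner E r mu s0 sig tau].
  have [le|lt] := leP lam (1 - e); first by exists lam.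
  have x0 : 0 <= 1 - e by rewrite subr_ge0.
  have x1 : 1 - e < 1 by rewrite gtrBl.
  exists (1 - e); split=> //; apply: (@SI_run_transfer _ _ _ _ _ m lam) => //.
    by rewrite mulnA.
  exact: ltW.
have [K0 K0le stop] := @SI_stop_bound V owner E R r mu mu0 mu1 s0 sig tau Eok ss0 run'
  (N ^ 2)%N (pow_sqr_lt _ _ _ N0 mu0 mue).
have exK : exists k, [forall v, owner v ==> (sig k.+1 v == sig k v)].
  by exists K0; apply/forallP => v; rewrite stop eqxx implybT.
case: (ex_minnP exK) => K /forallP Kstop Kmin.
have eK : eq_strat1 owner (sig K.+1) (sig K).
  by move=> v ov; apply/eqP; have := Kstop v; rewrite ov.
exists K; split=> //; last exact: opt; last first.
  move=> k kK ek; have := Kmin k; rewrite leqNgt kK => /(_ _)/negP[] //.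
  by apply/forallP => v; apply/implyP => ov; rewrite ek.
have Kle : (K.+1 <= n ^ (20 * m + 13))%N.
  apply: leq_trans (steps_le_pow n m W N n2 mW erefl).
  rewrite ltnS (leq_trans _ K0le) // Kmin //.
  by apply/forallP => v; rewrite stop eqxx implybT.
pose z : R := W%:R `^ 4%:R^-1 * Num.sqrt n%:R.
have z0 : 0 <= z by rewrite mulr_ge0 ?powR_ge0.
have z4 : z ^+ 4 = (W * n ^ 2)%:R.
  rewrite exprMn -powR_mulrn ?powR_ge0 // -powRrM mulVf ?pnatr_eq0 // powRr1 //.
  by rewrite (_ : 4%N = (2 * 2)%N) // exprM sqr_sqrtr // natrM natrX.
(* Minimality of m gives (m - 1)^4 <= 32 W (2n + 1)^2, which is at most 5^4 W n^2 = (5 z)^4. *)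
have mz : m%:R <= 1 + 5 * z.
  have m0 : (0 < m)%N by case: (m) mW.
  have le4 : (m.-1 ^ 4 <= 32 * W * (2 * n).+1 ^ 2)%N.
    by rewrite leqNgt; apply/negP => /mmin; rewrite -ltnS prednK // ltnn.
  rewrite -(prednK m0) -natr1 addrC lerD2l -(@ler_pXn2r _ 4) ?nnegrE ?mulr_ge0 //.
  rewrite exprMn z4 -!natrX -natrM ler_nat (leq_trans le4) //.
  nia.
apply: (@le_trans _ _ ((n ^ (20 * m + 13))%:R)); first by rewrite ler_nat.
rewrite natrX -powR_mulrn // ler_powR ?ler1n //.
rewrite -/z natrD natrM; lra.
Qed.
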